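(* Assume the generalized continuum hypothesis. Let $\aleph$ be an uncountable cardinal. Then every $(1,\aleph)$-injective Banach space is universally $(1,\aleph)$-injective.
   Context: All Banach spaces are real, ''operator'' means bounded linear map, ''subspace'' means closed linear subspace, and $\operatorname{dens}(X)$ is the smallest cardinality of a dense subset of $X$. The generalized continuum hypothesis states that $\kappa^+=2^\kappa$ for all infinite cardinals $\kappa$. For an uncountable cardinal $\aleph$, a Banach space $E$ is $(1,\aleph)$-injective if for every Banach space $X$ with $\operatorname{dens}(X)<\aleph$ and every subspace $Y\subset X$, every operator $t:Y\to E$ has an extension to an operator $T:X\to E$ with $\|T\|\leq\|t\|$. $E$ is universally $(1,\aleph)$-injective if the same holds for every Banach space $X$ (of any density) and every subspace $Y\subset X$ with $\operatorname{dens}(Y)<\aleph$. *)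

(* Defs.v *)
From mathcomp Require Import all_boot all_order all_algebra.
From mathcomp Require Import all_classical all_reals all_analysis.

Set Implicit Arguments.
Unset Strict Implicit.
Unset Printing Implicit Defensive.

Import Order.TTheory GRing.Theory Num.Theory.
Import numFieldNormedType.Exports.

Local Open Scope classical_set_scope.
Local Open Scope ring_scope.

(* A cardinal is represented by any type (or set) of that cardinality. *)
Definition card_lt (T U : Type) (A : set T) (B : set U) : Prop :=
  (A #<= B)%card /\ ~ (B #<= A)%card.

Definition is_successor_card (A B : Type) : Prop :=
  card_lt [set: A] [set: B] /\
  forall C : Type, card_lt [set: A] [set: C] -> ([set: B] #<= [set: C])%card.

(* [set A] is the power set of [A], so this reads kappa^+ = 2^kappa. *)
Definition GCH : Prop :=
  forall A : Type, infinite_set [set: A] -> is_successor_card A (set A).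

Definition dense_in (X : topologicalType) (A D : set X) : Prop :=
  D `<=` A /\ A `<=` closure D.

(* The cardinality of [D] is dens(A). *)
Definition realizes_dens (X : topologicalType) (A D : set X) : Prop :=
  dense_in A D /\ forall D' : set X, dense_in A D' -> (D #<= D')%card.

Definition dens_lt (X : topologicalType) (A : set X) (aleph : Type) : Prop :=
  exists2 D : set X, realizes_dens A D & card_lt D [set: aleph].

Section Operators.
Variables (R : realType) (X E : completeNormedModType R).
Implicit Types (Y : set X) (t : X -> E).

Definition is_subspace Y : Prop :=
  closed Y /\ submod_closed [in Y].

(* An operator on a subspace Y of X is encoded by a total function on X, whose
   values outside Y are irrelevant. *)
Definition linear_on Y t : Prop :=
  forall a : R, {in Y &, {morph t : u v / a *: u + v}}.

Definition bounded_on Y t : Prop :=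
  exists M : R, {in Y, forall y, `|t y| <= M * `|y|}.

Definition is_operator_on Y t : Prop := linear_on Y t /\ bounded_on Y t.

Definition opnorm_on Y t : R :=
  sup [set `|t y| | y in [set y | Y y /\ `|y| <= 1]].

Definition has_extension_norm_le Y t : Prop :=
  exists T : {linear X -> E},
    [/\ bounded_on [set: X] T,
        {in Y, forall y, T y = t y}
      & opnorm_on [set: X] T <= opnorm_on Y t].

End Operators.

Definition injective1 (R : realType) (aleph : Type)
    (E : completeNormedModType R) : Prop :=
  forall X : completeNormedModType R, dens_lt [set: X] aleph ->
  forall (Y : set X) (t : X -> E), is_subspace Y -> is_operator_on Y t ->
    has_extension_norm_le Y t.

Definition universally_injective1 (R : realType) (aleph : Type)
    (E : completeNormedModType R) : Prop :=
  forall (X : completeNormedModType R) (Y : set X), is_subspace Y ->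
  dens_lt Y aleph ->
  forall t : X -> E, is_operator_on Y t -> has_extension_norm_le Y t.

(* Main.v *)
(* Let t : Y -> E with Y in X, and let K be infinite with dens(Y) <= K < aleph.
   Functionals norming a dense subset of Y give an operator S of norm at most 1
   from X to the bounded functions on K that is isometric on Y. Under GCH there
   are at most 2^K = K^+ functions K -> R, so they have a well-order all of
   whose segments have cardinality at most K. Extend t, keeping |t v| bounded by
   |t| times the supremum norm of S v, one vector at a time in the order given
   by the images under S. At each stage the images of the current domain and of
   the new vector lie in a Banach space of density at most K, where
   (1,aleph)-injectivity supplies the next value. *)

Require Import Defs.
From HB Require Import structures.
From mathcomp Require Import all_boot all_order all_algebra.
From mathcomp Require Import all_classical all_reals all_analysis.
From mathcomp Require wochoice.
From mathcomp Require Import ring.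

Set Implicit Arguments.
Unset Strict Implicit.
Unset Printing Implicit Defensive.

Local Open Scope classical_set_scope.

(** * Cardinality *)

Definition embeds (T U : Type) : Prop := exists f : T -> U, injective f.

Lemma sval_inj (T : Type) (P : T -> Prop) : injective (@sval T P).
Proof. by move=> u v; apply: eq_sig_hprop => ? ? ?; exact: Prop_irrelevance. Qed.

Lemma embeds_trans (T U V : Type) : embeds T U -> embeds U V -> embeds T V.
Proof. by move=> [f fi] [g gi]; exists (g \o f); exact: inj_comp. Qed.

Lemma card_le_embeds (T U : Type) (A : set T) (B : set U) :
  (A #<= B)%card <-> embeds A B.
Proof.
split=> [/card_leP[f]|[f fi]].
  by exists f => x y fxy; apply: (@inj _ _ _ f); rewrite ?inE.
apply/card_leP/injfunPex; exists f => //.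
by move=> x y _ _; exact: fi.
Qed.

Lemma embeds_setT (T : Type) : embeds [set: T] T /\ embeds T [set: T].
Proof.
split; first by exists val; exact: val_inj.
by exists (fun x => SigSub (mem_set (I : [set: T] x))) => x y [].
Qed.

Lemma card_leT_embeds (T U : Type) : ([set: T] #<= [set: U])%card <-> embeds T U.
Proof.
have [TT' T'T] := embeds_setT T; have [UU' U'U] := embeds_setT U.
rewrite card_le_embeds; split=> h.
  exact: embeds_trans (embeds_trans T'T h) UU'.
exact: embeds_trans (embeds_trans TT' h) U'U.
Qed.

Lemma total_on_two (T : Type) (F : set (set T)) (X Y : set T) :
  total_on F subset -> F X -> F Y -> exists Z, [/\ F Z, X `<=` Z & Y `<=` Z].
Proof. by move=> tF FX FY; case: (tF _ _ FX FY) => ?; [exists Y|exists X]; split. Qed.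

(** Zorn's lemma for the sets [X] with [P (X]|[G0)]. The empty chain is covered by [P G0], so only
    nonempty chains have to be checked. *)
Lemma Zorn_above (T : Type) (P : set (set T)) (G0 : set T) : P G0 ->
  (forall F : set (set T), F !=set0 -> F `<=` P -> total_on F subset ->
    P (\bigcup_(X in F) X)) ->
  exists G, [/\ P G, G0 `<=` G & forall H, P H -> G `<=` H -> H `<=` G].
Proof.
move=> P0 Pchain.
have [F FP tF|G [PG Gmax]] := @Zorn_bigcup _ [set X | P (X `|` G0)].
  have [F0|/set0P Fn0] := eqVneq F set0.
    by rewrite /= F0 bigcup_set0 set0U.
  rewrite /= -bigcupUl//.
  rewrite (_ : \bigcup_(i in F) _ = \bigcup_(X in [set X `|` G0 | X in F]) X); last first.
    by rewrite bigcup_image.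
  apply: Pchain.
  - by case: Fn0 => X FX; exists (X `|` G0), X.
  - by move=> _ [X FX <-]; exact: FP.
  - move=> _ _ [X FX <-] [Y FY <-].
    by case: (tF _ _ FX FY) => h; [left|right]; exact: setSU.
exists (G `|` G0); split; [exact: PG|exact: subsetUr|move=> H PH GH].
apply: contrapT => nHG; apply: (Gmax H).
  split; first exact: subset_trans GH.
  by move=> HG; apply: nHG; apply: subset_trans HG _; exact: subsetUl.
have /setUidPl : G0 `<=` H by apply: subset_trans GH; exact: subsetUr.
by rewrite /= => ->.
Qed.

(* A maximal subset M of the product on which every projection is injective
   has a surjective projection: else a point avoiding all the images could be
   added to M. *)
Lemma least_embeds (I : Type) (X : I -> Type) : inhabited I ->
  exists i, forall j, embeds (X i) (X j).
Proof.
move=> [i0].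
pose P (M : set (forall i, X i)) :=
  forall i x y, M x -> M y -> x i = y i -> x = y.
have [F FP tF|M [PM Mmax]] := @Zorn_bigcup _ P.
  move=> i x y [A FA Ax] [B FB By] /=.
  have [C [FC AC BC]] := total_on_two tF FA FB.
  by apply: (FP _ FC); [exact: AC|exact: BC].
have [[i Mi]|nM] := pselect (exists i, forall a : X i, exists x, M x /\ x i = a).
  exists i => j; have [g gP] := choice Mi.
  exists (fun a => g a j) => a b gab.
  have [[Ma <-] [Mb <-]] := (gP a, gP b).
  by rewrite (PM _ _ _ Ma Mb gab).
have nz : forall i, exists a : X i, forall x, M x -> x i <> a.
  move=> i; apply: contrapT => h; apply: nM; exists i => a; apply: contrapT => k.
  by apply: h; exists a => x Mx xa; apply: k; exists x.
pose z i := projT1 (cid (nz i)).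
have zP i x : M x -> x i <> z i by move=> Mx; exact: (projT2 (cid (nz i))).
exfalso; apply: (Mmax (M `|` [set z])).
  split; first exact: subsetUl.
  by move=> /(_ z (or_intror erefl)) Mz; apply: (zP i0 z Mz).
move=> i x y [Mx|->] [My|->] // e; first exact: PM e.
  by case: (zP i x Mx).
by case: (zP i y My).
Qed.

Lemma embeds_total (T U : Type) : embeds T U \/ embeds U T.
Proof.
have [[] h] := least_embeds (fun b : bool => if b then T else U) (inhabits true).
  by left; exact: (h false).
by right; exact: (h true).
Qed.

Section Square.
Variable A : Type.
Implicit Types G : set (A * A * A).

(* G is the graph of an injective map from S * S to S, where S is the set of
   those u with (u, u) in the domain of G. *)
Let side G : set A := [set u | exists z, G (u, u, z)].

Definition square_graph G : Prop :=
  [/\ forall u v z z', G (u, v, z) -> G (u, v, z') -> z = z',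
      forall u v u' v' z, G (u, v, z) -> G (u', v', z) -> (u, v) = (u', v'),
      forall u v, side G u -> side G v -> exists z, G (u, v, z)
    & forall u v z, G (u, v, z) -> [/\ side G u, side G v & side G z]].

Let graph_of (S : set A) (op : A -> A -> A) : set (A * A * A) :=
  [set x | [/\ S x.1.1, S x.1.2 & x.2 = op x.1.1 x.1.2]].

Let side_graph_of S op : side (graph_of S op) = S.
Proof.
by apply/seteqP; split=> [u [z []]//|u Su]; exists (op u u); split.
Qed.

Let square_graph_of S op : (forall x y, S x -> S y -> S (op x y)) ->
  (forall x y x' y', S x -> S y -> S x' -> S y' -> op x y = op x' y' ->
    (x, y) = (x', y')) ->
  square_graph (graph_of S op).
Proof.
move=> opS opi; split=> [u v z z'|u v u' v' z|u v|u v z].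
- by move=> [/= _ _ ->] [/= _ _ ->].
- by move=> [/= Su Sv ->] [/= Su' Sv' e]; exact: opi.
- by rewrite side_graph_of => Su Sv; exists (op u v).
- by rewrite side_graph_of => -[/= Su Sv ->]; split=> //; exact: opS.
Qed.

Let square_graph_bigcup (F : set (set (A * A * A))) :
  F `<=` square_graph -> total_on F subset ->
  square_graph (\bigcup_(X in F) X).
Proof.
move=> FP tF.
have mono G G' : G `<=` G' -> side G `<=` side G'.
  by move=> GG' u [z Gz]; exists z; exact: GG'.
split=> [u v z z'|u v u' v' z|u v|u v z].
- move=> [X FX Xz] [Y FY Yz]; have [Z [FZ XZ YZ]] := total_on_two tF FX FY.
  by have [+ _ _ _] := FP _ FZ; apply; [exact: XZ Xz|exact: YZ Yz].
- move=> [X FX Xz] [Y FY Yz]; have [Z [FZ XZ YZ]] := total_on_two tF FX FY.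
  by have [_ + _ _] := FP _ FZ; apply; [exact: XZ Xz|exact: YZ Yz].
- move=> [z [X FX Xz]] [z' [Y FY Yz]].
  have [Z [FZ XZ YZ]] := total_on_two tF FX FY.
  have [_ _ + _] := FP _ FZ => /(_ u v)[||t Zt]; last by exists t; exists Z.
    by exists z; exact: XZ.
  by exists z'; exact: YZ.
- move=> [X FX Xz]; have [_ _ _ /(_ _ _ _ Xz)[? ? ?]] := FP _ FX.
  by split; apply: (mono X) => //; exact: bigcup_sup.
Qed.

(* Zorn: a maximal injection S * S -> S has S equipotent to A, for otherwise S
   embeds in its complement, and with C a copy of S there,
   (S u C)^2 \ S^2 embeds in three copies of S * S, hence in C. *)
Lemma embeds_square : infinite_set [set: A] -> embeds (A * A) A.
Proof.
move=> /infiniteP /card_leT_embeds[f fi].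
(* The starting graph is a pairing function of the naturals carried to [range f]; the [xget] terms
   invert [f]. It guarantees that [B] below contains every [f n], which then serve as tags. *)
have [|F _ FP tF|G [PG G0G Gmax]] := Zorn_above
  (P := square_graph)
  (G0 := graph_of (range f) (fun x y =>
     f (pickle (xget 0 [set n | f n = x], xget 0 [set n | f n = y])))).
- apply: square_graph_of => [x y _ _|_ _ _ _ [m _ <-] [n _ <-] [m' _ <-] [n' _ <-]].
    by eexists.
  have fK k : xget 0 [set n | f n = f k] = k.
    by apply: fi; apply: (@xgetPex _ 0 [set n | f n = f k]); exists k.
  by rewrite !fK => /fi /(pcan_inj pickleK)[-> ->].
- exact: square_graph_bigcup.
have [Gf Gi Gt Gs] := PG.
pose B := side G.
have Bf n : B (f n).
  by eexists; apply: G0G; split=> //=; exists n.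
have : forall uv : A * A, exists z, B uv.1 -> B uv.2 -> G (uv, z).
  move=> [u v] /=; have [[Bu Bv]|nB] := pselect (B u /\ B v).
    by have [z Gz] := Gt _ _ Bu Bv; exists z.
  by exists u => Bu Bv; exfalso; exact: nB.
move=> /choice[g' g'P]; pose g u v := g' (u, v).
have gP u v : B u -> B v -> G (u, v, g u v) by exact: (g'P (u, v)).
have gB u v : B u -> B v -> B (g u v).
  by move=> Bu Bv; have [] := Gs _ _ _ (gP _ _ Bu Bv).
have gi u v u' v' : B u -> B v -> B u' -> B v' -> g u v = g u' v' ->
    u = u' /\ v = v'.
  move=> Bu Bv Bu' Bv' e; have := gP _ _ Bu Bv; rewrite e => h.
  by have [-> ->] := Gi _ _ _ _ _ h (gP _ _ Bu' Bv').
have neqf m n : f m = f n -> m = n by exact: fi.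
(* If the complement of [B] embeds in [B], then [A] embeds in two tagged copies of [B], hence in
   [B], and [g] pairs the images. Otherwise [B] has a copy [C] in its complement, and [G] can be
   enlarged. *)
have [[phi phii]|[psi' psi'i]] := embeds_total {u | ~ B u} {u | B u}.
  pose h x := if pselect (B x) is right nB then g (f 1) (sval (phi (exist _ x nB)))
              else g (f 0) x.
  have hB x : B (h x).
    by rewrite /h; case: pselect => Bx; apply: gB => //; apply: svalP.
  have hi : injective h.
    move=> x y; rewrite /h; case: pselect => Bx; case: pselect => By;
      move=> /gi[]//; try exact: svalP.
    - by move=> /neqf.
    - by move=> /neqf.
    - by move=> _ /sval_inj/phii-[].
  exists (fun xy => g (h xy.1) (h xy.2)) => -[x y] [x' y'] /= /gi[]//.
  by move=> /hi -> /hi ->.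
have [psi psiB psii] : exists2 psi : A -> A, (forall u, B u -> ~ B (psi u)) &
    forall u v, B u -> B v -> psi u = psi v -> u = v.
  exists (fun u => if pselect (B u) is left Bu then sval (psi' (exist _ u Bu)) else u).
    by move=> u Bu; case: pselect => // Bu'; exact: (svalP (psi' _)).
  move=> u v Bu Bv; case: pselect => // {}Bu; case: pselect => // {}Bv.
  by move=> /sval_inj/psi'i-[].
pose C := [set psi u | u in B].
have /choice[pi piP] : forall x, exists u, (B `|` C) x ->
    B u /\ (B x -> x = u) /\ (~ B x -> x = psi u).
  move=> x; have [Bx|nBx] := pselect (B x); first by exists x => _; split=> //; split.
  have [[u Bu ux]|nC] := pselect (C x); first by exists u => _; split=> //; split.
  by exists x => -[].
have piB x : (B `|` C) x -> B (pi x) by move=> /piP[].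
have pii x y : (B `|` C) x -> (B `|` C) y -> (B x <-> B y) -> pi x = pi y -> x = y.
  move=> BCx BCy xy e; have [_ [h1 h2]] := piP _ BCx; have [_ [h3 h4]] := piP _ BCy.
  have [Bx|nBx] := pselect (B x); first by rewrite h1// h3 -?xy.
  by rewrite h2// h4 -?xy// e.
(* [pi] sends both [B] and [C] to [B]. The tag [k] recovers what [pi] forgets: which of the blocks B
   x C, C x B, C x C contains the new pair. *)
pose k x y : nat := if pselect (B x) then 0%N else if pselect (B y) then 1%N else 2.
pose op x y := if pselect (B x /\ B y) then g x y
               else psi (g (f (k x y)) (g (pi x) (pi y))).
have cl x y : (B `|` C) x -> (B `|` C) y -> B (g (f (k x y)) (g (pi x) (pi y))).
  by move=> BCx BCy; exact: gB (Bf _) (gB _ _ (piB _ BCx) (piB _ BCy)).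
have opBC x y : (B `|` C) x -> (B `|` C) y -> (B `|` C) (op x y).
  move=> BCx BCy; rewrite /op; case: pselect => [[Bx By]|nB] /=.
    by left; exact: gB.
  by right; exact: imageP (cl _ _ BCx BCy).
have : square_graph (graph_of (B `|` C) op).
  apply: square_graph_of opBC _ => x y x' y' BCx BCy BCx' BCy'.
  rewrite /op; case: pselect => [[Bx By]|nB] /=; case: pselect => [[Bx' By']|nB'] /=.
  - by move=> /gi[]// -> ->.
  - move=> e; exfalso; apply: (psiB _ (cl _ _ BCx' BCy')); rewrite -e.
    exact: gB.
  - move=> e; exfalso; apply: (psiB _ (cl _ _ BCx BCy)); rewrite e.
    exact: gB.
  move=> /psii-/(_ (cl _ _ BCx BCy) (cl _ _ BCx' BCy')) /gi[]//.
  - by apply: gB; exact: piB.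
  - by apply: gB; exact: piB.
  move=> /neqf kk /gi[]; try exact: piB.
  move=> px py; have [h1 h2] : (B x <-> B x') /\ (B y <-> B y').
    move: kk nB nB'; rewrite /k.
    by do 4!case: pselect => ?; rewrite //= => *; split; tauto.
  by rewrite (pii _ _ BCx BCx' h1 px) (pii _ _ BCy BCy' h2 py).
move=> /Gmax GmaxP.
have GG' : G `<=` graph_of (B `|` C) op.
  move=> [[u v] z] Gz; have [Bu Bv Bz] := Gs _ _ _ Gz.
  split; [by left|by left|rewrite /= /op]; case: pselect => h /=; last by case: h.
  exact: Gf Gz (gP _ _ Bu Bv).
(* Maximality puts the whole of [C] inside [B], in particular the point [psi (f 0)]. *)
exfalso; apply: (psiB (f 0) (Bf 0)).
have [|] := Gs (psi (f 0)) (psi (f 0)) (op (psi (f 0)) (psi (f 0))) _; last by [].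
by apply: (GmaxP GG'); split=> //=; right; exists (f 0).
Qed.

End Square.

(** Fold the pairing over the list. The length is stored too, because the code [f 0] of the empty
    list may also be the code of a pair. *)
Lemma embeds_seq (A : Type) : infinite_set [set: A] -> embeds (seq A) A.
Proof.
move=> Ainf; have [pr pri] := embeds_square Ainf.
have /infiniteP /card_leT_embeds[f fi] := Ainf.
pose code := foldr (fun x c => pr (x, c)) (f 0).
exists (fun s => pr (f (size s), code s)) => s t /pri[/fi].
elim: s t => [|x s IH] [|y t]//= [/IH{}IH] /pri[-> /IH ->].
by [].
Qed.

Lemma embeds_prod (T T' U U' : Type) : embeds T U -> embeds T' U' ->
  embeds (T * T') (U * U').
Proof.
by move=> [f fi] [g gi]; exists (fun x => (f x.1, g x.2)) => -[x y] [x' y'] [/fi-> /gi->].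
Qed.

Lemma embeds_sum (A T U : Type) : infinite_set [set: A] ->
  embeds T A -> embeds U A -> embeds (T + U) A.
Proof.
move=> Ainf [f fi] [g gi]; have [pr pri] := embeds_square Ainf.
have /infiniteP /card_leT_embeds[n ni] := Ainf.
exists (fun x => match x with inl t => pr (n 0, f t) | inr u => pr (n 1, g u) end).
by move=> [x|x] [y|y] /pri[]; [move=> /fi->|move=> /ni|move=> /ni|move=> /gi->].
Qed.

Section GCH_well_order.
Variables (gch : GCH) (A F : Type).
Hypothesis Ainf : infinite_set [set: A].

(** By comparability [C] is strictly larger than [A], hence at least its successor, which is [set A]
    under GCH. *)
Lemma gch_embeds (C : Type) : ~ embeds C A -> embeds (set A) C.
Proof.
move=> nCA; have [_] := gch Ainf; move=> /(_ C) h; apply/card_leT_embeds/h.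
split; last by move/card_leT_embeds.
by apply/card_leT_embeds; have [] := embeds_total A C.
Qed.

(* In the well-order of F, the least closed segment not embedding in A has an
   open segment into which set A embeds, by GCH: pull the order back along
   F -> set A -> that open segment. *)
Lemma gch_well_order : embeds F (set A) ->
  exists le : F -> F -> Prop,
    (forall S : set F, S !=set0 -> exists2 x, S x & forall y, S y -> le x y) /\
    (forall x, embeds {y | le y x} A).
Proof.
move=> FA; have [R Rwo] := wochoice.well_ordering_principle {classic F}.
have Rmin (S : set F) : S !=set0 -> exists2 x, S x & forall y, S y -> R x y.
  move=> [x Sx]; have [|z [[zS zmin] _]] := Rwo (mem S).
    by exists x; rewrite inE.
  by exists z; [rewrite inE in zS|move=> y Sy; apply: zmin; rewrite inE].
have Rtot x y : R x y \/ R y x.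
  have [|z [->|->] zmin] := Rmin [set x; y]; first by exists x; left.
    by left; apply: zmin; right.
  by right; apply: zmin; left.
have Ranti x y : R x y -> R y x -> x = y.
  move=> Rxy Ryx; have [|z [_ zu]] := Rwo (mem [set x; y]).
    by exists x; rewrite !inE; left.
  have Rxx u : R u u by have [] := Rtot u u.
  transitivity z; [symmetry|]; apply: zu; split; rewrite ?inE;
    try (by [left|right]); by move=> t; rewrite !inE => -[->|->].
have [[x0 nx0]|nex] := pselect (exists x, ~ embeds {y | R y x} A); last first.
  exists R; split=> //.
  by move=> x; apply: contrapT => h; apply: nex; exists x.
have [|x nx xmin] := Rmin [set x | ~ embeds {y | R y x} A]; first by exists x0.
pose C := {y | R y x /\ y <> x}.
have [phi phii] : embeds F C.
  (* If the open segment [C] embedded in [A], so would the closed one, which has a single further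
     point. *)
  apply: embeds_trans FA (gch_embeds _) => CA; apply: nx.
  apply: embeds_trans (embeds_sum Ainf CA (_ : embeds unit A)).
    exists (fun y : {y | R y x} => match pselect (sval y = x) with
      | left _ => inr tt
      | right h => inl (exist _ (sval y) (conj (svalP y) h)) end).
    move=> [y Ry] [z Rz] /=; case: pselect => hy; case: pselect => hz // e.
      by apply: sval_inj; rewrite /= hy hz.
    by apply: sval_inj; case: e.
  have /infiniteP /card_leT_embeds[f _] := Ainf.
  by exists (fun _ => f 0) => -[] [].
exists (fun u v => R (sval (phi u)) (sval (phi v))); split.
- move=> S [s Ss]; have [|z [u Su <-] umin] := Rmin [set sval (phi u) | u in S].
    by exists (sval (phi s)), s.
  by exists u => // v Sv; apply: umin; exists v.
- move=> u; have [Rux ux] := svalP (phi u).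
  have seg : embeds {y | R y (sval (phi u))} A.
    apply: contrapT => h; apply: ux; apply: Ranti => //; exact: xmin.
  apply: embeds_trans seg.
  exists (fun v : {v | R (sval (phi v)) (sval (phi u))} =>
    exist (fun y => R y (sval (phi u))) (sval (phi (sval v))) (svalP v)).
  move=> [v Rv] [w Rw] /= [] e.
  have vw : v = w.
    by apply: phii; exact: sval_inj.
  by exact: sval_inj.
Qed.

End GCH_well_order.

(** * Dominated linear graphs and the Hahn-Banach theorem *)

Import Order.TTheory GRing.Theory Num.Theory.
Import numFieldNormedType.Exports.

Local Open Scope ring_scope.

Section Graphs.
Variables (R : realType) (V : lmodType R) (E : normedModType R) (p : V -> R).
Implicit Types (G : set (V * E)) (v w : V) (e c : E).

Definition graph_dom G : set V := [set v | exists e, G (v, e)].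

(** Partial linear maps are relations here, so that unions of chains need no gluing. When [p 0 = 0],
    single-valuedness follows from the bound: two values at one vector differ by a value at 0. *)
Definition dominated_graph G : Prop :=
  [/\ G (0, 0),
      forall a v e v' e', G (v, e) -> G (v', e') -> G (a *: v + v', a *: e + e')
    & forall v e, G (v, e) -> `|e| <= p v].

Definition extend_graph G w c : set (V * E) :=
  [set x | exists v e a, G (v, e) /\ x = (v + a *: w, e + a *: c)].

Lemma sub_extend_graph G w c : G `<=` extend_graph G w c.
Proof. by move=> [v e] Gve; exists v, e, 0; rewrite !scale0r !addr0. Qed.

Lemma extend_graph_dom G w c v : graph_dom (extend_graph G w c) v ->
  exists u a, graph_dom G u /\ v = u + a *: w.
Proof. by move=> [_ [u [e [a [Gue [-> _]]]]]]; exists u, a; split=> //; exists e. Qed.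

Lemma dominated_extend_graph G w c : dominated_graph G ->
  (forall a v e, G (v, e) -> `|e + a *: c| <= p (v + a *: w)) ->
  dominated_graph (extend_graph G w c).
Proof.
move=> [G0 Glin _] wc; split; first exact: sub_extend_graph.
  move=> a v e v' e' [u [d [b [Gud [-> ->]]]]] [u' [d' [b' [Gud' [-> ->]]]]].
  exists (a *: u + u'), (a *: d + d'), (a * b + b'); split; first exact: Glin.
  by congr pair; rewrite scalerDl -scalerA scalerDr addrACA.
by move=> v e [u [d [b [Gud [-> ->]]]]]; exact: wc.
Qed.

Lemma dominated_graph_fun G : p 0 = 0 -> dominated_graph G ->
  forall v e e', G (v, e) -> G (v, e') -> e = e'.
Proof.
move=> p0 [_ Glin Gp] v e e' Ge Ge'; apply/eqP; rewrite -subr_eq0 -normr_le0.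
rewrite -p0 -distrC; apply: Gp.
by have := Glin (-1) _ _ _ _ Ge Ge'; rewrite !scaleN1r addNr addrC.
Qed.

Lemma dominated_graph_bigcup (F : set (set (V * E))) : F !=set0 ->
  F `<=` dominated_graph -> total_on F subset ->
  dominated_graph (\bigcup_(G in F) G).
Proof.
move=> [H FH] FP tF; split.
- by exists H => //; have [] := FP _ FH.
- move=> a v e v' e' [X FX Xz] [Y FY Yz].
  have [Z [FZ XZ YZ]] := total_on_two tF FX FY; exists Z => //.
  by have [_ + _] := FP _ FZ; apply; [exact: XZ|exact: YZ].
- by move=> v e [X FX Xz]; have [_ _ ] := FP _ FX; apply.
Qed.

(** Zorn's lemma reduces total extension to adding one vector. [Q] is an invariant of the domain
    that each step may use and must restore: trivial for Hahn-Banach, a restriction on the order of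
    adding vectors for the final extension. *)
Lemma dominated_graph_total (Q : set V -> Prop) : p 0 = 0 ->
  (forall F : set (set V), F !=set0 -> F `<=` Q -> total_on F subset ->
    Q (\bigcup_(D in F) D)) ->
  (forall G, dominated_graph G -> Q (graph_dom G) -> graph_dom G <> setT ->
    exists w c, [/\ ~ graph_dom G w, Q (graph_dom (extend_graph G w c))
      & forall a v e, G (v, e) -> `|e + a *: c| <= p (v + a *: w)]) ->
  forall G0, dominated_graph G0 -> Q (graph_dom G0) ->
  exists T : {linear V -> E},
    (forall v, `|T v| <= p v) /\ (forall v e, G0 (v, e) -> T v = e).
Proof.
move=> p0 Qchain Qstep G0 dG0 QG0.
have [//|F Fn0 FP tF|G [[dG QG] G0G Gmax]] := Zorn_above
  (P := [set G | dominated_graph G /\ Q (graph_dom G)]) (G0 := G0).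
  split; first by apply: dominated_graph_bigcup => // X /FP[].
  rewrite (_ : graph_dom _ = \bigcup_(D in [set graph_dom X | X in F]) D).
    apply: Qchain.
    - by case: Fn0 => X FX; exists (graph_dom X), X.
    - by move=> _ [X FX <-]; have [] := FP _ FX.
    - move=> _ _ [X FX <-] [Y FY <-].
      by case: (tF _ _ FX FY) => h; [left|right] => v [e Ge]; exists e; exact: h.
  rewrite bigcup_image; apply/seteqP; split=> v.
    by move=> [e [X FX Xe]]; exists X => //; exists e.
  by move=> [X FX [e Xe]]; exists e, X.
have Gtot : graph_dom G = setT.
  apply: contrapT => nT; have [w [c [nw Qw wc]]] := Qstep _ dG QG nT.
  apply: nw; exists c; apply: (Gmax (extend_graph G w c)).
  - by split=> //; exact: dominated_extend_graph.
  - exact: sub_extend_graph.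
  - have [G00 _ _] := dG; exists 0, 0, 1; split=> //.
    by rewrite !scale1r !add0r.
have /choice[T TG] : forall v, exists e, G (v, e).
  by move=> v; have : graph_dom G v by rewrite Gtot.
have Glin := let: And3 _ h _ := dG in h.
have Tlin : linear T.
  by move=> a u v; exact: dominated_graph_fun p0 dG _ _ _ (TG _) (Glin _ _ _ _ _ (TG u) (TG v)).
pose T' : {linear V -> E} := HB.pack T (GRing.isLinear.Build _ _ _ _ T Tlin).
exists T'; split=> [v|v e Ge]; first by have [_ _] := dG; apply; exact: TG.
exact: dominated_graph_fun p0 dG _ _ _ (TG _) (G0G _ Ge).
Qed.

End Graphs.

(** For [a = 1] the value [c] must lie between all [- e - |v + w|] and all [|v + w| - e]; the
    triangle inequality separates these two families, and [c] is the supremum of the first. Scaling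
    by [a^-1] gives the other nonzero [a]. *)
Lemma hahn_banach_one_step (R : realType) (X : normedModType R)
    (G : set (X * R^o)) (w : X) :
  dominated_graph (fun x => `|x|) G ->
  exists c : R^o, forall a v e, G (v, e) -> `|e + a *: c| <= `|v + a *: w|.
Proof.
move=> [G0 Glin Gp].
pose S : set R := [set - x.2 - `|x.1 + w| | x in G].
have Sub v e : G (v, e) -> ubound S (`|v + w| - e).
  move=> Ge _ [[u d] Gd <-] /=; rewrite lerBlDr addrAC lerBrDr.
  have := Glin (-1) _ _ _ _ Gd Ge; rewrite !scaleN1r => /Gp.
  move=> /(le_trans (ler_norm _)) h.
  rewrite (le_trans h)//.
  have -> : - u + v = (v + w) - (u + w) by rewrite opprD addrACA subrr addr0 addrC.
  exact: ler_normB.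
have Sn0 : S !=set0 by exists (- 0 - `|0 + w|), (0, 0).
have Ssup : has_sup S by split=> //; exists (`|0 + w| - 0); exact: Sub.
pose c : R := sup S.
have h1 v e : G (v, e) -> `|e + c| <= `|v + w|.
  move=> Ge; rewrite ler_norml; apply/andP; split.
    rewrite -lerBlDl addrC; apply: sup_upper_bound => //; exists (v, e) => //.
  rewrite -lerBrDl; apply: ge_sup => //; exact: Sub.
exists c => a v e Ge; have [->|a0] := eqVneq a 0.
  by rewrite !scale0r !addr0; exact: Gp.
have -> : e + a *: (c : R^o) = a *: ((a^-1 *: e + c) : R^o).
  by rewrite scalerDr scalerA divff// scale1r.
have -> : v + a *: w = a *: (a^-1 *: v + w).
  by rewrite scalerDr scalerA divff// scale1r.
rewrite !normrZ ler_wpM2l//; apply: h1.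
by have := Glin a^-1 _ _ _ _ Ge G0; rewrite !addr0.
Qed.

Lemma norming_functional (R : realType) (X : normedModType R) (x0 : X) :
  exists f : {linear X -> R^o}, (forall x, `|f x| <= `|x|) /\ f x0 = `|x0|.
Proof.
pose G0 : set (X * R^o) := [set x | exists a : R, x = (a *: x0, a * `|x0|)].
have [|||||f [fb fG0]] := @dominated_graph_total R X R^o (fun x => `|x|) (fun=> True) _ _ _ G0.
- exact: normr0.
- by [].
- move=> G dG _ nT; have [w nw] : exists w, ~ graph_dom G w.
    by apply/existsNP => h; apply: nT; apply/seteqP; split.
  by have [c wc] := hahn_banach_one_step w dG; exists w, c.
- split.
  + by exists 0; rewrite scale0r mul0r.
  + move=> a _ _ _ _ [b [-> ->]] [b' [-> ->]]; exists (a * b + b').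
    by rewrite scalerDl scalerA mulrDl -mulrA.
  + by move=> _ _ [b [-> ->]]; rewrite !normrZ normr_id.
- by [].
exists f; split=> //; apply: fG0; exists 1.
by rewrite scale1r mul1r.
Qed.

(** * Banach spaces of bounded functions *)

Section FunctionSpace.
Variables (R : realType) (A : Type).

Definition bounded_by (f : A -> R^o) (M : R) := forall a, `|f a| <= M.

(** These are the closed subspaces of the space of bounded functions on [A]. Closedness is stated by
    uniform bounds, since the norm is only put on the type built from the set. *)
Record function_space := FunctionSpace {
  fs_set :> set (A -> R^o);
  fs_bounded : forall f, fs_set f -> exists M, bounded_by f M;
  fs_submod : submod_closed [in fs_set];
  fs_closed : forall f, (forall eps, 0 < eps ->
    exists2 g, fs_set g & bounded_by (f - g) eps) -> fs_set f }.

(* The value 0 makes the set nonempty when A is empty. *)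
Definition supnorm (f : A -> R^o) : R :=
  sup [set r | r = 0 \/ exists a, r = `|f a|].

Let supnorm_has_sup f M : bounded_by f M ->
  has_sup [set r | r = 0 \/ exists a, r = `|f a|].
Proof.
move=> fM; split; first by exists 0; left.
exists `|M| => _ [->//|[a ->]]; exact: le_trans (fM a) (ler_norm M).
Qed.

Lemma supnorm_ge f M a : bounded_by f M -> `|f a| <= supnorm f.
Proof.
by move=> /supnorm_has_sup fs; apply: sup_upper_bound => //; right; exists a.
Qed.

Lemma supnorm_le f M : 0 <= M -> bounded_by f M -> supnorm f <= M.
Proof.
move=> M0 fM; apply: ge_sup; first by exists 0; left.
by move=> _ [->//|[a ->]].
Qed.

Lemma supnorm_ge0 f M : bounded_by f M -> 0 <= supnorm f.
Proof.
by move=> /supnorm_has_sup fs; apply: sup_upper_bound => //; left.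
Qed.

Section FunctionSpaceType.
Variable W : function_space.

Definition fs_pred : {pred A -> R^o} := [in fs_set W].

Record fs_type := FsType { fs_val :> A -> R^o; fs_valP : fs_val \in fs_pred }.

HB.instance Definition _ := [isSub for fs_val].
HB.instance Definition _ := [Choice of fs_type by <:].
HB.instance Definition _ := GRing.isSubmodClosed.Build R (A -> R^o)
  fs_pred (fs_submod W).
HB.instance Definition _ := [SubChoice_isSubLmodule of fs_type by <:].

Implicit Types x y : fs_type.

Lemma fs_val_bounded x : bounded_by x (supnorm x).
Proof.
move=> a; have [M xM] := fs_bounded (set_mem (fs_valP x)).
exact: supnorm_ge xM.
Qed.

Let fs_norm_ge0 x : 0 <= supnorm x.
Proof.
have [M xM] := fs_bounded (set_mem (fs_valP x)); exact: supnorm_ge0 xM.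
Qed.

Let fs_ler_normD x y : supnorm (x + y) <= supnorm x + supnorm y.
Proof.
apply: supnorm_le => [|a]; first by rewrite addr_ge0.
by rewrite (le_trans (ler_normD _ _))// lerD// fs_val_bounded.
Qed.

Let fs_normrZ k x : supnorm (k *: x) = `|k| * supnorm x.
Proof.
have le k' y : supnorm (k' *: y) <= `|k'| * supnorm y.
  apply: supnorm_le => [|a]; first by rewrite mulr_ge0.
  by rewrite normrZ ler_wpM2l// fs_val_bounded.
apply/eqP; rewrite eq_le le/=.
have [->|k0] := eqVneq k 0; first by rewrite normr0 mul0r; exact: (fs_norm_ge0 (0 *: x)).
rewrite -ler_pdivlMl ?normr_gt0// -normfV.
rewrite -[X in supnorm (fs_val X) <= _](_ : k^-1 *: (k *: x) = x)//.
by rewrite scalerA mulVf// scale1r.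
Qed.

Let fs_normr0_eq0 x : supnorm x = 0 -> x = 0.
Proof.
move=> x0; apply: val_inj; apply/funext => a /=.
by apply/eqP; rewrite -normr_le0 -[X in _ <= X]x0 fs_val_bounded.
Qed.

HB.instance Definition _ := Lmodule_isNormed.Build R fs_type
  fs_ler_normD fs_normrZ fs_normr0_eq0.

Lemma fs_normE x : `|x| = supnorm x. Proof. by []. Qed.

Lemma fs_norm_ge x a : `|x a| <= `|x|.
Proof. exact: fs_val_bounded. Qed.

(** The pointwise limit [g] stays within [d] of the centre of every ball of radius [d] in the
    filter, uniformly in the argument. Hence [g] lies in [W] and is the limit in norm. *)
Let fs_complete (F : set_system fs_type) : ProperFilter F -> cauchy F -> cvg F.
Proof.
move=> FF /cauchyP Fc.
have /choice[g gP] : forall a, exists l : R^o, forall d, 0 < d ->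
    F [set f : fs_type | `|l - f a| < d].
  move=> a; have /cvg_ex[l /cvgr_dist_lt Fl] : cvg ((fun f : fs_type => f a) @ F).
    apply: cauchy_cvg; apply: cauchy_exP => eps eps0.
    have [x Fx] := Fc _ eps0.
    exists (x a); suff : F [set f : fs_type | ball (x a) eps (f a)] by [].
    apply: filterS Fx => f; rewrite -!ball_normE /=.
    by apply: le_lt_trans; exact: (fs_norm_ge (x - f) a).
  by exists l => d d0; exact: Fl.
have xg x d a : F (ball x d) -> `|g a - x a| <= d.
  move=> Fx; apply/ler_addgt0Pl => e e0.
  have [f [/= gf xf]] := filter_ex (filterI (gP a _ e0) Fx).
  rewrite -(subrKA (f a)) (le_trans (ler_normD _ _))// lerD// ltW//.
  move: xf; rewrite -ball_normE /= distrC; apply: le_lt_trans.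
  exact: (fs_norm_ge (f - x) a).
have Wg : fs_set W g.
  apply: fs_closed => eps eps0; have [x Fx] := Fc _ eps0.
  exists x; first exact: set_mem (fs_valP x).
  by move=> a; exact: xg.
apply/cvg_ex; exists (FsType (mem_set Wg)).
apply/cvg_ballP => eps eps0.
have eps20 : 0 < eps / 2 by rewrite divr_gt0.
have [x Fx] := Fc _ eps20.
apply: filterS (Fx) => f; rewrite -!ball_normE /= => xf.
rewrite -(subrKA x) (le_lt_trans (ler_normD _ _))// [ltRHS]splitr ler_ltD//.
by apply: supnorm_le; [exact: ltW|move=> a; exact: xg].
Qed.

HB.instance Definition _ := Uniform_isComplete.Build fs_type fs_complete.

Definition fs_banach : completeNormedModType R := fs_type.

End FunctionSpaceType.
End FunctionSpace.

(** * Extension of operators *)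

Section ClosureGraph.
Variables (R : realType) (B : normedModType R) (E : completeNormedModType R).
Variables (M : R) (G : set (B * E)).
Hypotheses (M0 : 0 <= M) (dG : dominated_graph (fun b => M * `|b|) G).

(** Closing the graph in the product makes its domain a closed subspace, as injectivity demands. *)
Definition closure_graph : set (B * E) := [set x | forall eps, 0 < eps ->
  exists b e, [/\ G (b, e), `|x.1 - b| < eps & `|x.2 - e| < eps]].

Lemma sub_closure_graph : G `<=` closure_graph.
Proof. by move=> [b e] Gbe eps eps0; exists b, e; rewrite /= !subrr !normr0. Qed.

Lemma dominated_closure_graph : dominated_graph (fun b => M * `|b|) closure_graph.
Proof.
have [G0 Glin Gb] := dG; split; first exact: sub_closure_graph.
  move=> a v e v' e' cv cv' eps eps0.
  have a1 : 0 < `|a| + 1 by rewrite ltr_wpDl.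
  pose del := eps / (`|a| + 1).
  have del0 : 0 < del by rewrite divr_gt0.
  have near (V : normedModType R) (x x' y y' : V) :
      `|x - y| < del -> `|x' - y'| < del ->
      `|a *: x + x' - (a *: y + y')| < eps.
    move=> xy xy'; rewrite opprD addrACA -scalerBr.
    rewrite (le_lt_trans (ler_normD _ _))// normrZ.
    rewrite (_ : eps = `|a| * del + del).
      by rewrite ler_ltD// ler_wpM2l// ltW.
    by rewrite -{2}[del]mul1r -mulrDl mulrC divfK// gt_eqF.
  have [u [d [Gu ud ed]]] := cv _ del0.
  have [u' [d' [Gu' ud' ed']]] := cv' _ del0.
  by exists (a *: u + u'), (a *: d + d'); split; [exact: Glin|exact: near|exact: near].
move=> b e be; apply/ler_addgt0Pl => eps eps0.
pose del := eps / (1 + M).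
have M1 : 0 < 1 + M by rewrite ltr_pwDl.
have del0 : 0 < del by rewrite divr_gt0.
have [u [d [Gu bu ed]]] := be _ del0.
rewrite -(subrK d e) (le_trans (ler_normD _ _))//.
rewrite (_ : eps = del + M * del); last first.
  by rewrite -{1}[del]mul1r -mulrDl mulrC divfK// gt_eqF.
rewrite -addrA; apply: lerD; first exact: ltW.
rewrite (le_trans (Gb _ _ Gu))// -mulrDr ler_wpM2l//.
rewrite -(subrK b u) (le_trans (ler_normD _ _))// lerD2r distrC.
exact: ltW.
Qed.

(** The values of [G] at points tending to [b] form a Cauchy filter, as values at [u] and [u']
    differ by at most [M * |u - u'|]; completeness of [E] gives the value at [b]. *)
Lemma closure_graph_dom b : (forall eps, 0 < eps ->
    exists2 u, graph_dom G u & `|b - u| < eps) -> graph_dom closure_graph b.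
Proof.
move=> bG; have [_ Glin Gb] := dG.
pose near eps : set E := [set e | exists2 u, G (u, e) & `|b - u| < eps].
pose F := filter_from [set eps : R | 0 < eps] near.
have FF : ProperFilter F.
  apply: filter_from_proper; last first.
    by move=> eps /bG[u [e Ge] bu]; exists e, u.
  apply: filter_from_filter; first by exists 1; rewrite /= ltr01.
  move=> d d' d0 d'0; exists (Num.min d d'); first by rewrite /= lt_min; apply/andP.
  by move=> e [u Ge]; rewrite lt_min => /andP[? ?]; split; exists u.
have Fc : cauchy F.
  apply: cauchy_exP => eps eps0.
  (* Two points within [del] of [b] have values at distance at most [2 * M * del]; the summand 1
     makes this strictly less than [eps], also for [M = 0]. *)
  pose del := eps / (1 + M * 2).
  have M1 : 0 < 1 + M * 2 by rewrite ltr_pwDl// mulr_ge0.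
  have del0 : 0 < del by rewrite divr_gt0.
  have [u [e Ge] bu] := bG _ del0; exists e; exists del => //.
  move=> e' [u' Ge' bu']; rewrite -ball_normE /=.
  have := Glin (-1) _ _ _ _ Ge Ge'; rewrite !scaleN1r => /Gb.
  rewrite distrC [e' - e]addrC => /le_lt_trans; apply.
  rewrite (_ : eps = del + M * (del + del)); last first.
    by rewrite -mulr2n -[del *+ 2]mulr_natl mulrA -{1}[del]mul1r -mulrDl mulrC divfK// gt_eqF.
  rewrite ltr_pwDl// ler_wpM2l//.
  rewrite addrC -(subrKA b) (le_trans (ler_normD _ _))// lerD// ltW//.
  by rewrite distrC.
have /cvg_ex[l Fl] : cvg F by exact: cauchy_cvg.
exists l => eps eps0; have [del /= del0 delP] := Fl _ (nbhsx_ballx l _ eps0).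
have [|u [e Ge] bu] := bG (Num.min del eps); first by rewrite lt_min del0.
move: bu; rewrite lt_min => /andP[ud ue].
exists u, e; split=> //.
by have /delP : near del e by [exists u]; rewrite -ball_normE.
Qed.

End ClosureGraph.

Section OperatorNorm.
Variables (R : realType) (X E : completeNormedModType R).
Variables (Y : set X) (t : X -> E).
Hypotheses (subY : submod_closed [in Y]).

Lemma opnorm_on_le M : 0 <= M -> {in Y, forall y, `|t y| <= M * `|y|} ->
  opnorm_on Y t <= M.
Proof.
move=> M0 tM; apply: ge_sup.
  exists `|t 0|, 0 => //; split; last by rewrite normr0.
  by have [+ _] := subY; rewrite inE.
move=> _ [y [Yy y1] <-]; rewrite (le_trans (tM y _)) ?inE//.
by rewrite ler_piMr.
Qed.

Lemma opnorm_on_has_sup : bounded_on Y t ->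
  has_sup [set `|t y| | y in [set y | Y y /\ `|y| <= 1]].
Proof.
move=> [M tM]; split.
  exists `|t 0|, 0 => //; split; last by rewrite normr0.
  by have [+ _] := subY; rewrite inE.
exists `|M| => _ [z [Yz z1] <-]; rewrite (le_trans (tM z _)) ?inE//.
rewrite (le_trans (ler_norm _))// normrM normr_id.
by rewrite ler_piMr.
Qed.

Lemma opnorm_on_ge0 : bounded_on Y t -> 0 <= opnorm_on Y t.
Proof.
move=> /opnorm_on_has_sup ts; apply: (le_trans (normr_ge0 (t 0))).
apply: sup_upper_bound => //; exists 0 => //; split; last by rewrite normr0.
by have [+ _] := subY; rewrite inE.
Qed.

Lemma opnorm_on_ge : linear_on Y t -> bounded_on Y t ->
  {in Y, forall y, `|t y| <= opnorm_on Y t * `|y|}.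
Proof.
move=> tlin tbd y Yy; have [Y0 Ylin] := subY.
have t0 : t 0 = 0.
  by have := tlin (-1) _ _ Y0 Y0; rewrite !scaleN1r oppr0 addr0 addNr.
have tZ k : t (k *: y) = k *: t y.
  by have := tlin k _ _ Yy Y0; rewrite t0 !addr0.
have [->|y0] := eqVneq y 0; first by rewrite t0 !normr0 mulr0.
rewrite -ler_pdivrMr ?normr_gt0// mulrC -(normr_id y) -normfV -normrZ -tZ.
apply: sup_upper_bound; first exact: opnorm_on_has_sup.
exists (`|y|^-1 *: y) => //; split.
  by have := Ylin `|y|^-1 _ _ Yy Y0; rewrite addr0 inE.
by rewrite normrZ normfV normr_id mulVf// normr_eq0.
Qed.
End OperatorNorm.

(** Cardinals are well-ordered: [least_embeds] is applied to the family of all dense subsets, with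
    [A] itself as a member. *)
Lemma realizes_dens_exists (X : topologicalType) (A : set X) :
  exists D, realizes_dens A D.
Proof.
have [|[D AD] Dmin] := @least_embeds {D : set X | dense_in A D} (fun D => sval D).
  by constructor; exists A; split=> //; exact: subset_closure.
exists D; split=> // D' AD'; apply/card_le_embeds.
exact: (Dmin (exist _ D' AD')).
Qed.

Lemma dens_lt_embeds (X : topologicalType) (A D : set X) (K aleph : Type) :
  dense_in A D -> embeds D K -> embeds K aleph -> ~ embeds aleph K ->
  dens_lt A aleph.
Proof.
move=> AD DK Ka naK; have [D' [AD' D'min]] := realizes_dens_exists A.
have D'K : embeds D' K.
  by apply: embeds_trans DK; apply/card_le_embeds; exact: D'min.
have [ST TS] := embeds_setT aleph.
exists D' => //; split.
  by apply/card_le_embeds; exact: embeds_trans (embeds_trans D'K Ka) TS.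
move=> /card_le_embeds aD'; apply: naK.
exact: embeds_trans (embeds_trans TS aD') D'K.
Qed.

(** Injectivity in the form used below: the domain may fail to be closed, and a bound [M] replaces
    the operator norm. *)
Lemma injective1_dominated (R : realType) (aleph : Type)
    (E B : completeNormedModType R) (M : R) (G : set (B * E)) :
  injective1 aleph E -> dens_lt [set: B] aleph -> 0 <= M ->
  dominated_graph (fun b => M * `|b|) G ->
  exists T : {linear B -> E},
    (forall b, `|T b| <= M * `|b|) /\ (forall b e, G (b, e) -> T b = e).
Proof.
move=> injE densB M0 dG.
have dC := dominated_closure_graph M0 dG; have [C0 Clin Cb] := dC.
have Cfun : forall b e e', closure_graph G (b, e) -> closure_graph G (b, e') -> e = e'.
  by apply: dominated_graph_fun dC; rewrite /= normr0 mulr0.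
pose Y := graph_dom (closure_graph G).
have /choice[t tP] : forall b, exists e, Y b -> closure_graph G (b, e).
  move=> b; have [[e be]|nY] := pselect (Y b); first by exists e.
  by exists 0.
have subY : submod_closed [in Y].
  split; first by rewrite inE; exists 0.
  move=> a u v; rewrite !inE => -[e ue] [e' ve']; exists (a *: e + e').
  exact: Clin.
have closedY : closed Y.
  move=> b bY; apply: closure_graph_dom dG _ _ => // eps eps0.
  have eps20 : 0 < eps / 2 by rewrite divr_gt0.
  have [y [[e ye]]] := bY _ (nbhsx_ballx b _ eps20).
  rewrite -ball_normE /= => by_.
  have [u [d [Gud /= yu _]]] := ye _ eps20; exists u; first by exists d.
  rewrite -(subrKA y) (le_lt_trans (ler_normD _ _))// [ltRHS]splitr.
  exact: ltrD.
have tlin : linear_on Y t.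
  move=> a u v; rewrite !inE => Yu Yv.
  have [] := subY; move=> _ /(_ a u v); rewrite !inE => /(_ Yu Yv) Yuv.
  exact: Cfun (tP _ Yuv) (Clin _ _ _ _ _ (tP _ Yu) (tP _ Yv)).
have tM : {in Y, forall y, `|t y| <= M * `|y|}.
  by move=> y; rewrite inE => Yy; exact: Cb (tP _ Yy).
have tbd : bounded_on Y t by exists M.
have [T [Tbd Tt Tle]] := injE B densB Y t (conj closedY subY) (conj tlin tbd).
have TM b : `|T b| <= M * `|b|.
  have subT : submod_closed [in [set: B]] by split=> [|a u v _ _]; rewrite inE.
  have Tlin : linear_on [set: B] T by move=> a u v _ _; exact: linearP.
  rewrite (le_trans (opnorm_on_ge subT Tlin Tbd _))// ?inE//.
  rewrite ler_wpM2r// (le_trans Tle)//; exact: opnorm_on_le.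
exists T; split=> // b e Gbe; have Cbe := sub_closure_graph Gbe.
have Yb : Y b by exists e.
by rewrite Tt ?inE//; exact: Cfun (tP _ Yb) Cbe.
Qed.

(** * Closed spans of few bounded functions *)

Section RatSpan.
Variables (R : realType) (A J : Type) (h : J -> A -> R^o).
Implicit Types (f g : A -> R^o) (s : seq (rat * J)).

Definition rat_comb s : A -> R^o := \sum_(x <- s) ratr x.1 *: h x.2.

Lemma rat_comb_cat s s' : rat_comb (s ++ s') = rat_comb s + rat_comb s'.
Proof. by rewrite /rat_comb big_cat. Qed.

Lemma rat_combZ q s :
  rat_comb [seq (q * x.1, x.2) | x <- s] = ratr q *: rat_comb s.
Proof.
rewrite /rat_comb big_map scaler_sumr; apply: eq_bigr => x _ /=.
by rewrite scalerA rmorphM.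
Qed.

(** The uniform closure of the rational combinations is already a real subspace, and rational
    coefficients keep the dense set small. *)
Definition rat_span : set (A -> R^o) := [set f | forall eps, 0 < eps ->
  exists s, bounded_by (f - rat_comb s) eps].

Lemma rat_span_comb s : rat_span (rat_comb s).
Proof.
by move=> eps eps0; exists s => a; rewrite subrr normr0 ltW.
Qed.

Lemma rat_span_gen j : rat_span (h j).
Proof.
have -> : h j = rat_comb [:: (1, j)]; last exact: rat_span_comb.
by rewrite /rat_comb big_seq1 /= rmorph1 scale1r.
Qed.

Hypothesis hbd : forall j, exists M, bounded_by (h j) M.

Lemma rat_span_bounded f : rat_span f -> exists M, bounded_by f M.
Proof.
move=> /(_ 1 ltr01)[s fs].
have [M sM] : exists M, bounded_by (rat_comb s) M.
  rewrite /rat_comb; elim: s {fs} => [|x s [M IH]].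
    by exists 0 => a; rewrite big_nil normr0.
  have [M' hM'] := hbd x.2; exists (`|ratr x.1| * M' + M) => a.
  rewrite big_cons (le_trans (ler_normD _ _))// lerD//.
  by rewrite normrZ ler_wpM2l.
exists (1 + M) => a; rewrite -[f a](subrK (rat_comb s a)).
by rewrite (le_trans (ler_normD _ _))// lerD//; exact: fs.
Qed.

Lemma rat_span_submod : submod_closed [in rat_span].
Proof.
split.
  rewrite inE; have -> : 0 = rat_comb [::] by rewrite /rat_comb big_nil.
  exact: rat_span_comb.
move=> k u v; rewrite !inE => Wu Wv eps eps0.
have [M uM] := rat_span_bounded Wu.
(* Three errors of size [d]: replacing [k] by a rational [q], approximating [u] before
   multiplication by [q], and approximating [v]. The divisors [|M| + 1] and [|q| + 1] absorb the
   factors [u a] and [q]. *)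
pose d := eps / 3.
have d0 : 0 < d by rewrite divr_gt0.
have M1 : 0 < `|M| + 1 by rewrite ltr_wpDl.
pose d1 := d / (`|M| + 1).
have d10 : 0 < d1 by rewrite divr_gt0.
have [|q] := @rat_in_itvoo R (k - d1) (k + d1); first by rewrite ltrD2l gtrN.
rewrite in_itv/= -ltr_distlC => /ltW kq.
have q1 : 0 < `|ratr q : R| + 1 by rewrite ltr_wpDl.
have [s us] := Wu _ (divr_gt0 d0 q1).
have [s' vs'] := Wv _ d0.
exists ([seq (q * x.1, x.2) | x <- s] ++ s') => a.
rewrite rat_comb_cat rat_combZ.
rewrite (_ : _ a = (k - ratr q) *: u a + ratr q *: (u - rat_comb s) a + (v - rat_comb s') a).
  rewrite (le_trans (ler_normD _ _))// (_ : eps = d + d + d); last first.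
    by rewrite /d; field.
  rewrite lerD// (le_trans (ler_normD _ _))// lerD// normrZ.
    apply: (le_trans (ler_pM _ _ kq (uM a))) => //.
    rewrite /d1 mulrAC ler_pdivrMr// ler_wpM2l//; first exact: ltW.
    by rewrite (le_trans (ler_norm _))// lerDl.
  apply: (le_trans (ler_wpM2l _ (us a))) => //.
  rewrite mulrCA ger_pMr// ler_pdivrMr// mul1r lerDl//.
rewrite !fctE /GRing.scale /=; ring.
Qed.

Lemma rat_span_closed f : (forall eps, 0 < eps ->
  exists2 g, rat_span g & bounded_by (f - g) eps) -> rat_span f.
Proof.
move=> fW eps eps0; have eps20 : 0 < eps / 2 by rewrite divr_gt0.
have [g Wg fg] := fW _ eps20; have [s gs] := Wg _ eps20; exists s => a.
rewrite -[f - _](subrKA g) [leRHS]splitr.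
by rewrite (le_trans (ler_normD _ _))// lerD//.
Qed.

Definition rat_span_space : function_space R A :=
  FunctionSpace rat_span_bounded rat_span_submod rat_span_closed.

(** The rational combinations are dense and are coded by lists over [rat * J], of which there are at
    most [K]. *)
Lemma rat_span_dens_lt (K aleph : Type) : infinite_set [set: K] ->
  embeds J K -> embeds K aleph -> ~ embeds aleph K ->
  dens_lt [set: fs_banach rat_span_space] aleph.
Proof.
move=> Kinf JK.
pose D : set (fs_banach rat_span_space) := [set x | exists s, fs_val x = rat_comb s].
apply: (@dens_lt_embeds _ _ D); last first.
  have SK : embeds (seq (rat * J)) K.
    apply: embeds_trans (embeds_seq Kinf).
    have [g gi] : embeds (rat * J) K.
      apply: embeds_trans (embeds_square Kinf); apply: embeds_prod JK.
      have /infiniteP /card_leT_embeds := Kinf; apply: embeds_trans.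
      by exists pickle; exact: (pcan_inj pickleK).
    by exists (map g); exact: inj_map.
  apply: embeds_trans SK.
  have /choice[g gP] : forall x : D, exists s, fs_val (val x) = rat_comb s.
    by move=> x; have := valP x; rewrite inE.
  exists g => x y gxy; apply: val_inj; apply: val_inj => /=.
  by rewrite (gP x) (gP y) gxy.
split=> // x _ U /nbhs_ballP[eps /= eps0 epsU].
have eps20 : 0 < eps / 2 by rewrite divr_gt0.
have [s xs] := set_mem (fs_valP x) _ eps20.
pose y : fs_banach rat_span_space :=
  @FsType R A rat_span_space _ (mem_set (rat_span_comb s)).
exists y; split; first by exists s.
apply: epsU; rewrite -ball_normE /=.
apply: (@le_lt_trans _ _ (eps / 2)); last by rewrite gtr_pMr// invf_lt1// ltr1n.
by apply: supnorm_le => [|a]; [exact: ltW|exact: xs].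
Qed.

End RatSpan.

(** A real function is determined by the pairs [(k, q)] with [q] rational below its value at [k],
    and [K * rat] embeds in [K]. *)
Lemma embeds_fun_set (R : realType) (K : Type) : infinite_set [set: K] ->
  embeds (K -> R^o) (set K).
Proof.
move=> Kinf; have [g gi] : embeds (K * rat) K.
  apply: embeds_trans (embeds_square Kinf); apply: embeds_prod; first by exists id.
  have /infiniteP /card_leT_embeds := Kinf; apply: embeds_trans.
  by exists pickle; exact: (pcan_inj pickleK).
exists (fun f => [set g x | x in [set x | ratr x.2 < (f x.1 : R)]]) => f f' ff'.
have le (u v : K -> R) k : [set g x | x in [set x | ratr x.2 < u x.1]] =
    [set g x | x in [set x | ratr x.2 < v x.1]] -> u k <= v k.
  move=> uv; rewrite leNgt; apply/negP => /rat_in_itvoo[q].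
  rewrite in_itv/= => /andP[vq qu].
  have : [set g x | x in [set x | ratr x.2 < u x.1]] (g (k, q)) by exists (k, q).
  by rewrite uv => -[x xv /gi xkq]; rewrite xkq/= in xv; have := lt_trans xv vq; rewrite ltxx.
by apply/funext => k; apply/eqP; rewrite eq_le; apply/andP; split; exact: le.
Qed.

(** Take [D] itself if it is infinite and the naturals otherwise; the latter lie strictly below
    [aleph] by uncountability. *)
Lemma infinite_card_between (T aleph : Type) (D : set T) :
  ~ countable [set: aleph] -> card_lt D [set: aleph] ->
  exists K : Type,
    [/\ infinite_set [set: K], embeds D K, embeds K aleph & ~ embeds aleph K].
Proof.
move=> unc [/card_le_embeds Da naD]; have [ST TS] := embeds_setT aleph.
have aN : ~ embeds aleph nat by move=> /card_leT_embeds.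
have [Dinf|Dfin] := pselect (embeds nat D).
  exists D; split.
  - exact/infiniteP/card_leT_embeds.
  - by exists id.
  - exact: embeds_trans Da ST.
  - move=> aD; apply: naD; apply/card_le_embeds; exact: embeds_trans ST aD.
exists nat; split=> //; first exact: infinite_nat.
  by have [|//] := embeds_total D nat.
by have [//|] := embeds_total nat aleph.
Qed.

Lemma norming_family (R : realType) (X : normedModType R) (K : Type) (d : K -> X) :
  exists S : {linear X -> (K -> R^o)},
    (forall x, bounded_by (S x) `|x|) /\ forall k, S (d k) k = `|d k|.
Proof.
have /choice[f fP] : forall k, exists f : {linear X -> R^o},
    (forall x, `|f x| <= `|x|) /\ f (d k) = `|d k|.
  by move=> k; exact: norming_functional.
pose S x k := f k x.
have Slin : linear S by move=> a u v; apply/funext => k; exact: linearP.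
pose S' : {linear X -> (K -> R^o)} :=
  HB.pack S (GRing.isLinear.Build R X (K -> R^o) *:%R S Slin).
exists S'.
by split=> [x k|k]; have [fk fdk] := fP k; [exact: fk|exact: fdk].
Qed.

(** * Extension along the well-order *)

Section Extension.
Variables (gch : GCH) (R : realType) (aleph K : Type).
Variables (E X : completeNormedModType R).
Hypothesis injE : injective1 aleph E.
Hypotheses (Kinf : infinite_set [set: K]) (Ka : embeds K aleph).
Hypothesis naK : ~ embeds aleph K.
Variables (d : K -> X) (S : {linear X -> (K -> R^o)}).
Hypothesis Sbd : forall x, bounded_by (S x) `|x|.
Variable M : R.
Hypothesis M0 : 0 <= M.

Let p x := M * supnorm (S x).

(* Each time a vector w is added to the domain, S w is least, in a well-order
   of K -> R^o with segments embedding in K, among the S v with v outside the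
   domain, so the image of the domain is in the closed span of S \o d and of the
   S v <= S w, which has density at most K. *)
Lemma injective1_extension (G0 : set (X * E)) :
  dominated_graph p G0 ->
  (forall v eps, graph_dom G0 v -> 0 < eps -> exists k, `|v - d k| < eps) ->
  exists T : {linear X -> E},
    (forall v, `|T v| <= p v) /\ (forall v e, G0 (v, e) -> T v = e).
Proof.
move=> dG0 G0d.
have [le [lemin leK]] := gch_well_order gch Kinf (embeds_fun_set R Kinf).
have lexx g : le g g by have [|x -> h] := lemin [set g]; [exists g|exact: h].
pose J w : Type := (K + {g | le g (S w) /\ range S g})%type.
pose h w (j : J w) : K -> R^o :=
  match j with inl k => S (d k) | inr g => sval g end.
have hbd w j : exists M, bounded_by (h w j) M.
  case: j => [k|[g gP]]; first by exists `|d k|; exact: Sbd.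
  by have [_ [x _ Sx]] := gP; exists `|x|; rewrite /= -Sx; exact: Sbd.
have JK w : embeds (J w) K.
  apply: embeds_sum => //; first by exists id.
  apply: embeds_trans (leK (S w)).
  exists (fun g : {g | le g (S w) /\ range S g} =>
    exist (fun g => le g (S w)) (sval g) (svalP g).1) => g g' [] e.
  exact: sval_inj.
have Sw_in w w' : le (S w) (S w') -> rat_span (h w') (S w).
  move=> ww'; have Pw : le (S w) (S w') /\ range S (S w) by split=> //; exists w.
  exact: (rat_span_gen (h w') (inr (exist _ _ Pw))).
(* The condition concerns every [w] outside the domain, not just the next vector to be added, so it
   passes to unions of chains. *)
pose Q (D : set X) := forall w, ~ D w -> forall v, D v -> rat_span (h w) (S v).
apply: (@dominated_graph_total R X E p Q) => //.
- rewrite /p (_ : supnorm _ = 0) ?mulr0//; apply/eqP.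
  rewrite eq_le (supnorm_ge0 (Sbd 0)) andbT.
  by have := supnorm_le (normr_ge0 _) (Sbd 0); rewrite normr0.
- move=> F _ FQ _ w nw v [D FD Dv]; apply: (FQ D FD w _ v Dv) => Dw.
  by apply: nw; exists D.
- move=> G dG QG nT.
  have [|g [w nw <-] wmin] := lemin [set S w | w in ~` graph_dom G].
    have [w nw] : exists w, ~ graph_dom G w.
      by apply/existsNP => GT; apply: nT; apply/seteqP; split.
    by exists (S w), w.
  pose B := fs_banach (rat_span_space (hbd w)).
  have densB : dens_lt [set: B] aleph by exact: rat_span_dens_lt (JK w) Ka naK.
  pose mk g (Wg : rat_span (h w) g) : B :=
    @FsType R K (rat_span_space (hbd w)) g (mem_set Wg).
  (* The partial map is pushed forward along [S]. The bound survives because [p v] depends only on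
     [S v]. *)
  pose GB : set (B * E) := [set x | exists2 v, G (v, x.2) & fs_val x.1 = S v].
  have dGB : dominated_graph (fun b => M * `|b|) GB.
    have [G00 Glin Gp] := dG; split.
    + by exists 0 => //=; rewrite !linear0.
    + move=> a b e b' e' [v Gve /= bv] [v' Gve' /= bv'].
      exists (a *: v + v'); first exact: Glin.
      by rewrite /= !linearP bv bv'.
    + by move=> b e [v Gve /= bv]; rewrite fs_normE bv; exact: Gp.
  have [T [TM TG]] := injective1_dominated injE densB M0 dGB.
  pose bw := mk _ (Sw_in w w (lexx _)).
  exists w, (T bw); split=> //.
    move=> w' nw' v' /extend_graph_dom[u [a [Gu ->]]].
    (* A vector [w'] still outside was outside before, so [S w] precedes [S w'] by the choice of [w]
       and is one of the generators [h w']. *)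
    have nGw' : ~ graph_dom G w'.
      by move=> [e Ge]; apply: nw'; exists e; exact: sub_extend_graph.
    have ww' : le (S w) (S w') by apply: wmin; exists w'.
    rewrite addrC linearP; have [_] := rat_span_submod (hbd w').
    move=> /(_ a (S w) (S u)); rewrite !inE; apply; first exact: (Sw_in _ _ ww').
    exact: (QG _ nGw').
  move=> a v e Gve.
  have Wv : rat_span (h w) (S v) by apply: (QG _ nw); exists e.
  have <- : T (mk _ Wv) = e by apply: TG; exists v.
  rewrite addrC -linearP (le_trans (TM _))// fs_normE.
  by rewrite /p [v + _]addrC linearP.
- move=> w nw v Gv; apply: rat_span_closed => eps eps0.
  have [k vk] := G0d _ _ Gv eps0; exists (S (d k)).
    exact: (rat_span_gen (h w) (inl k)).
  by move=> a; rewrite -linearB (le_trans (Sbd _ _))// ltW.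
Qed.

End Extension.

Theorem proposition3p2 (gch : GCH) (R : realType) (aleph : Type)
    (uncountable_aleph : ~ countable [set: aleph])
    (E : completeNormedModType R) :
  injective1 aleph E -> universally_injective1 aleph E.
Proof.
move=> injE X Y [_ subY] [D [[DY YD] _] Dlt] t [tlin tbd].
have [K [Kinf [i ii] Ka naK]] := infinite_card_between uncountable_aleph Dlt.
(* [d] enumerates [D] by [K], with value 0 at indices outside the image of [i]. *)
have /choice[d dP] : forall k, exists x, forall z : D, i z = k -> x = val z.
  move=> k; have [[z zk]|nz] := pselect (exists z, i z = k).
    by exists (val z) => z'; rewrite -zk => /ii ->.
  by exists 0 => z zk; exfalso; apply: nz; exists z.
have Yd v eps : Y v -> 0 < eps -> exists k, `|v - d k| < eps.
  move=> Yv eps0; have [x [Dx]] := YD _ Yv _ (nbhsx_ballx v _ eps0).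
  rewrite -ball_normE /= => vx; exists (i (SigSub (mem_set Dx))).
  by rewrite (dP _ (SigSub (mem_set Dx))).
have [S [Sbd Sd]] := norming_family d.
(* [S] preserves the norm on [Y]: it attains the norm at each [d k], these points approximate [y],
   and [S] does not increase norms. *)
have SY y : Y y -> `|y| <= supnorm (S y).
  move=> Yy; apply/ler_addgt0Pl => eps eps0.
  have [k yk] := Yd _ _ Yy (divr_gt0 eps0 (ltr0n R 2)).
  have dk : `|d k| <= supnorm (S y) + eps / 2.
    rewrite -[leLHS]normr_id -Sd -[d k](subKr y) linearB.
    rewrite (le_trans (ler_normB _ _))// lerD//.
      exact: supnorm_ge (Sbd y).
    by rewrite (le_trans (Sbd _ _))// ltW.
  rewrite -[y in leLHS](subrK (d k)) (le_trans (ler_normD _ _))//.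
  by apply: le_trans (lerD (ltW yk) dk) _; rewrite addrCA -splitr addrC.
have M0 := opnorm_on_ge0 subY tbd.
set M := opnorm_on Y t in M0 *.
pose G0 : set (X * E) := [set x | Y x.1 /\ x.2 = t x.1].
have [||T [Tp TG]] := @injective1_extension gch R aleph K E X injE Kinf Ka naK
  d S Sbd M M0 G0.
- have [Y0 Ylin] := subY.
  have YP a u v : Y u -> Y v -> Y (a *: u + v).
    by have := Ylin a u v; rewrite !inE.
  rewrite inE in Y0; split.
  + split=> //=; have := tlin (-1) 0 0; rewrite !inE => /(_ Y0 Y0).
    by rewrite scaler0 addr0 scaleN1r addNr.
  + move=> a u _ v _ [/= Yu ->] [/= Yv ->]; split; first exact: YP.
    by rewrite /= tlin ?inE.
  + move=> y _ [/= Yy ->]; apply: (le_trans (opnorm_on_ge subY tlin tbd _)).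
      by rewrite inE.
    by rewrite ler_wpM2l// SY.
- by move=> v eps [e [Yv _]]; exact: Yd.
(* The bound by the supremum norm of [S x] becomes a bound by the norm of [x], again since [S] has
   norm at most 1. *)
have TM x : `|T x| <= M * `|x|.
  by rewrite (le_trans (Tp x))// ler_wpM2l// supnorm_le.
exists T; split.
- by exists M => x _.
- by move=> y; rewrite inE => Yy; apply: TG.
- apply: opnorm_on_le => //.
  by split=> [|a u v _ _]; rewrite inE.
Qed.
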